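(* For any integers $t\ge 2$ and $n\ge 4t-5$, there exists a set $H$ of pairwise intersecting $t$-intervals with $|H|=n$ such that every weakly intersecting subset $F\subseteq H$ satisfies $|F|\le \frac{3(t-1)}{4t-5}\,n$.
   Context: Let $R_1,\dots,R_t$ be disjoint parallel lines in the plane. A $t$-interval is a set of the form $I_1\cup\dots\cup I_t$ where each $I_j$ is a closed interval contained in $R_j$. A family of $t$-intervals is pairwise intersecting if any two of its members have a common point. A family of $t$-intervals is weakly intersecting if there is a set $P$ of points containing at most one point from each line $R_i$ such that every member of the family contains a point of $P$. *)

(* Defs.v *)
From mathcomp Require Import all_boot all_order all_algebra.
From mathcomp Require Import finmap.
From mathcomp Require Import boolp classical_sets set_interval reals.

Set Implicit Arguments.
Unset Strict Implicit.
Unset Printing Implicit Defensive.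

Import Order.TTheory GRing.Theory Num.Theory.
Local Open Scope classical_set_scope.
Local Open Scope ring_scope.

Notation plane R := 'rV[R]_2.

Section TIntervals.
Variable R : realType.

Definition line (p d : plane R) : set (plane R) := range (fun s : R => p + s *: d).

(* The common direction d makes the lines parallel; being nonempty and disjoint,
   they are also distinct. *)
Definition disjoint_parallel_lines (t : nat) (L : 'I_t -> set (plane R)) : Prop :=
  (exists2 d : plane R, d != 0 & forall j, exists p, L j = line p d) /\
  trivIset setT L.

Definition segment (x y : plane R) : set (plane R) :=
  (fun s : R => x + s *: (y - x)) @` `[0, 1].

(* Intervals are nonempty and bounded, and may be reduced to a point. *)
Definition is_t_interval (t : nat) (L : 'I_t -> set (plane R))
    (A : set (plane R)) : Prop :=
  exists I : 'I_t -> set (plane R),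
    (forall j, (exists x y, I j = segment x y) /\ I j `<=` L j) /\
    A = \bigcup_j I j.

Definition pairwise_intersecting (H : set (set (plane R))) : Prop :=
  forall A B, H A -> H B -> A <> B -> A `&` B !=set0.

Definition weakly_intersecting (t : nat) (L : 'I_t -> set (plane R))
    (F : set (set (plane R))) : Prop :=
  exists P : set (plane R),
    (forall j, is_subset1 (P `&` L j)) /\
    (forall A, F A -> A `&` P !=set0).

End TIntervals.

(* Main.v *)
Require Import Defs.
From mathcomp Require Import all_boot all_order all_algebra.
From mathcomp Require Import finmap.
From mathcomp Require Import boolp classical_sets set_interval reals.
From mathcomp Require Import zify lra.

Set Implicit Arguments.
Unset Strict Implicit.
Unset Printing Implicit Defensive.

(**
Let q = max(t-1, n/4) and t > 2.  The family has 4q structured members, in two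
groups, each group having two sides of q members, and n - 4q further members
that meet everything (if n = 4t-5 one structured member is dropped).
Lines 0 and 1 belong to the two groups.  On its own line a group occupies two
disjoint blocks, one per side, all members of a side being the same interval;
the members of the other group are disjoint points, put in the blocks so that
equal sides meet on line 0 and opposite sides on line 1.  What remains is to
make the two sides of one group meet.  Each index a > 0 is a hub of one of the
lines j > 1, where both members of index a in a group are long and meet the
whole opposite side.  The two members of index 0 meet on the line of the other
group, in the gap between the blocks.

A transversal choosing a block on lines 0 and 1 covers one side of each group
and one more member from the other group on each of the lines, and one of these
two is covered twice: this gives 2q + 1.  On a line j > 1 with h hubs it covers
members of one group only, and at most h on each side, hence at most h new
ones.  As there are q - 1 hubs, at most 3q structured members are covered;
choosing a gap on line 0 or 1 is no better.
*)

(** The cap at [t.-1] sends all surplus indices to the last line; for [t <= q.+1] every line [j > 1]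
    still gets a hub. *)
Definition hub (t j a : nat) : bool := (0 < a) && (minn a.+1 t.-1 == j).

(* [lo] and [hi] are the end points on line [j] of the member of group [g], side
   [s] and index [a].  On lines 0 and 1 the blocks are [0, q-1] and [q+1, 2q] and
   the gap is the point q; on the other lines the second group is shifted by
   2q+1 to keep it disjoint from the first. *)
Definition lo (q t j : nat) (g s : bool) (a : nat) : nat :=
  if j == g then (if s then q.+1 else 0)
  else if j == ~~ g then
    (if s (+) ~~ g then (if a == 0 then q else q.+1 + a) else q.-1 - a)
  else g * (q.*2.+1) +
    (if hub t j a then (if s then q else 0) else (if s then a else q.+1 + a)).

Definition hi (q t j : nat) (g s : bool) (a : nat) : nat :=
  if j == g then (if s then q.*2 else q.-1)
  else if j == ~~ g then
    (if s (+) ~~ g then q.+1 + a else (if a == 0 then q else q.-1 - a))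
  else g * (q.*2.+1) +
    (if hub t j a then (if s then q.*2 else q) else (if s then a else q.+1 + a)).

(** * Counting the members covered by a transversal *)

Definition fiber (q t j p : nat) (g s : bool) : {set 'I_q} :=
  [set a : 'I_q | lo q t j g s a <= p <= hi q t j g s a].

Lemma lo_le_hi q t j g s a : a < q -> lo q t j g s a <= hi q t j g s a.
Proof. by move=> aq; rewrite /lo /hi; do ![case: ifP => ?]; lia. Qed.

Lemma card_fiber_le q t j p g s : #|fiber q t j p g s| <= q.
Proof. by rewrite -[X in _ <= X]card_ord max_card. Qed.

Lemma card_fiber_own q t p (g s : bool) :
  #|fiber q t g p g s| <= (if s then q < p else p < q) * q.
Proof.
case: (boolP (if s then q < p else p < q)) => H.
  by rewrite mul1n card_fiber_le.
rewrite leqn0 cards_eq0; apply/eqP/setP => a; rewrite !inE /lo /hi eqxx.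
have := ltn_ord a; move: H; case: s => /=; lia.
Qed.

(** On this line the members of one side are pairwise disjoint. Both inequalities are weak because
    index 0 reaches into the gap [q]. *)
Lemma card_fiber_other q t p (g s : bool) :
  #|fiber q t (~~ g) p g s|
    <= (if s (+) ~~ g then q <= p else p <= q).
Proof.
case: (boolP (if s (+) ~~ g then q <= p else p <= q)) => H; last first.
  rewrite leqn0 cards_eq0; apply/eqP/setP => a; rewrite !inE /lo /hi eqxx.
  have := ltn_ord a; move: H; case: g; case: s => /=; case: ifP; lia.
apply/card_le1_eqP => a b; rewrite !inE /lo /hi eqxx => Ha Hb; apply: val_inj => /=.
have := ltn_ord a; have := ltn_ord b; move: Ha Hb; case: g H; case: s => /=;
  by do 2![case: ifP => ?]; lia.
Qed.

(* The members of group [false] lie in [0, 2q] and those of group [true] beyond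
   it, so one of the two fibers is empty. *)
Lemma card_fiber_hub q t p j (s s' : bool) : 1 < j -> j <= q -> j < t ->
  #|fiber q t j p false s| + #|fiber q t j p true s'|
    <= #|[set a : 'I_q | hub t j a]|.
Proof.
move=> j1 jq jt.
have jF b : (j == nat_of_bool b) = false by case: b; lia.
have h1 : 0 < #|[set a : 'I_q | hub t j a]|.
  have aq : j.-1 < q by lia.
  by apply/card_gt0P; exists (Ordinal aq); rewrite inE /hub /=; lia.
have key g b : #|fiber q t j p g b| <= #|[set a : 'I_q | hub t j a]|.
  (* A non-hub is a point missed by all other members of its side, so a fiber containing one is a
     singleton, and [h1] bounds it. *)
  have [H|H] := boolP [exists a in fiber q t j p g b, ~~ hub t j a]; last first.
    apply: subset_leq_card; apply/fintype.subsetP => a af; rewrite inE.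
    by move: H; rewrite negb_exists_in => /forall_inP/(_ a af)/negPn.
  apply: leq_trans h1; apply/card_le1_eqP => x y.
  case/exists_inP: H => z; rewrite !inE /lo /hi !jF => Hz zh Hx Hy.
  apply: val_inj => /=; move: Hz Hx Hy; rewrite (negbTE zh).
  have := ltn_ord x; have := ltn_ord y; have := ltn_ord z.
  by case: g; case: b; case: (hub t j x); case: (hub t j y); lia.
have [H|H] := leqP p q.*2.
  suff -> : fiber q t j p true s' = finset.set0 by rewrite cards0 addn0.
  apply/setP => a; rewrite !inE /lo /hi !jF; lia.
suff -> : fiber q t j p false s = finset.set0 by rewrite cards0 add0n.
apply/setP => a; rewrite !inE /lo /hi !jF; have := ltn_ord a.
by case: (hub t j a); case: s; lia.
Qed.

(** Double counting: index 0 is no hub, and any other index is a hub of at most one line. *)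
Lemma sum_card_hub q t : \sum_(j < t) #|[set a : 'I_q | hub t j a]| <= q.-1.
Proof.
have -> : \sum_(j < t) #|[set a : 'I_q | hub t j a]| =
    \sum_(a < q) #|[set j : 'I_t | hub t j a]|.
  under eq_bigr do rewrite -sum1dep_card big_mkcond /=.
  rewrite exchange_big /=; apply: eq_bigr => a _.
  by rewrite -sum1dep_card [RHS]big_mkcond.
case: q => [|q]; first by rewrite big_ord0.
rewrite big_ord_recl (_ : #|_| = 0) ?add0n; last first.
  by apply/eqP; rewrite cards_eq0; apply/eqP/setP => j; rewrite !inE.
rewrite -[X in _ <= X]card_ord -sum1_card; apply: leq_sum => a _.
apply/card_le1_eqP => i j; rewrite !inE => /andP[_ /eqP i_] /andP[_ /eqP j_].
by apply: val_inj; rewrite /= -i_.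
Qed.

Lemma card_exists_le (T : finType) (n : nat) (A : 'I_n -> {set T}) :
  #|[set x | [exists j, x \in A j]]| <= \sum_j #|A j|.
Proof.
rewrite -sum1dep_card big_mkcond /=.
under [X in _ <= X]eq_bigr do rewrite -sum1_card big_mkcond /=.
rewrite exchange_big /=; apply: leq_sum => x _.
case: ifP => // /existsP[j xj]; by rewrite (bigD1 j) //= xj.
Qed.

Lemma card_cover (q t : nat) (p : 'I_t -> nat) : 1 < q -> 2 < t -> t <= q.+1 ->
  #|[set x : bool * bool * 'I_q |
      [exists j : 'I_t, x.2 \in fiber q t j (p j) x.1.1 x.1.2]]| <= 3 * q.
Proof.
move=> q1 t2 tq; case: t p t2 tq => [|[|t]] // p t2 tq.
set U := [set x | _].
pose N g s := #|[set a : 'I_q | [exists j : 'I_t.+2, a \in fiber q t.+2 j (p j) g s]]|.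
pose R g s := \sum_(j < t) #|fiber q t.+2 j.+2 (p (lift ord0 (lift ord0 j))) g s|.
have Nq g s : N g s <= q by rewrite -[X in _ <= X]card_ord max_card.
have NR g s : N g s <= #|fiber q t.+2 0 (p ord0) g s|
    + (#|fiber q t.+2 1 (p (lift ord0 ord0)) g s| + R g s).
  by apply: leq_trans (card_exists_le _) _; rewrite !big_ord_recl.
have Rq s s' : R false s + R true s' <= q.-1.
  apply: leq_trans (sum_card_hub q t.+2).
  rewrite !big_ord_recl /= addnA -big_split /=; apply: leq_trans (leq_addl _ _).
  by apply: leq_sum => j _; apply: card_fiber_hub => //; have := ltn_ord j; lia.
have -> : #|U| = N false false + N false true + (N true false + N true true).
  rewrite -sum1dep_card big_mkcond /=.
  rewrite (eq_bigr (fun x : bool * bool * 'I_q => if [exists j : 'I_t.+2,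
    x.2 \in fiber q t.+2 j (p j) x.1.1 x.1.2] then 1 else 0)) //.
  rewrite -(pair_bigA _ (fun gs a => if [exists j : 'I_t.+2,
    a \in fiber q t.+2 j (p j) gs.1 gs.2] then 1 else 0)) /=.
  rewrite -(pair_bigA _ (fun g s => \sum_a if [exists j : 'I_t.+2,
    a \in fiber q t.+2 j (p j) g s] then 1 else 0)) /=.
  have NE g s : \sum_a (if [exists j : 'I_t.+2,
      a \in fiber q t.+2 j (p j) g s] then 1 else 0) = N g s.
    by rewrite /N -sum1dep_card [RHS]big_mkcond.
  by rewrite !big_bool /= !NE; lia.
set p0 := p ord0 in NR; set p1 := p (lift ord0 ord0) in NR.
have own0 := card_fiber_own q t.+2 p0 false.
have own1 := card_fiber_own q t.+2 p1 true.
have oth0 := card_fiber_other q t.+2 p0 true.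
have oth1 := card_fiber_other q t.+2 p1 false.
move: (NR false false) (NR false true) (NR true false) (NR true true).
move: (own0 false) (own0 true) (own1 false) (own1 true).
move: (oth0 false) (oth0 true) (oth1 false) (oth1 true).
move: (Rq false false) (Rq false true) (Rq true false) (Rq true true).
move: (Nq false false) (Nq false true) (Nq true false) (Nq true true).
move=> /=.
(* With no gap chosen the total is at most 2q + 1 + (q-1); with one gap, q + 2 + 2(q-1); with two, 4
   + 2(q-1), which is at most 3q since q > 1. *)
case: (ltngtP p0 q) => _; case: (ltngtP p1 q) => _ /=; lia.
Qed.

(** * Intersections and distinctness of the structured members *)

Definition line_meet (q t j : nat) (g s : bool) (a : nat) (h u : bool) (b : nat) :=
  (lo q t j g s a <= hi q t j h u b) && (lo q t j h u b <= hi q t j g s a).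

Lemma line_meet_hub q t g s a u b : 2 < t -> a < q -> b < q -> 0 < a -> s != u ->
  line_meet q t (minn a.+1 t.-1) g s a g u b.
Proof.
move=> t2 aq bq a0; rewrite /line_meet /lo /hi.
have jF (c : bool) : (minn a.+1 t.-1 == c) = false by case: c; lia.
have -> : hub t (minn a.+1 t.-1) a by rewrite /hub a0 eqxx.
rewrite !jF; case: s; case: u => //= _; case: ifP => _; lia.
Qed.

Lemma pairwise_meet q t (g s : bool) (a : nat) (h u : bool) (b : nat) :
  1 < q -> 2 < t -> a < q -> b < q ->
  exists2 j, j < t & line_meet q t j g s a h u b.
Proof.
move=> q1 t2 aq bq; have [<-{h}|gh] := eqVneq g h.
  have [<-{u}|su] := eqVneq s u.
    exists (nat_of_bool g); first by case: g; lia.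
    by rewrite /line_meet /lo /hi eqxx; case: s; lia.
  have [a0|a0] := posnP a; last first.
    by exists (minn a.+1 t.-1); [lia|exact: line_meet_hub].
  have [b0|b0] := posnP b; last first.
    exists (minn b.+1 t.-1); first lia.
    by rewrite /line_meet andbC; apply: line_meet_hub => //; rewrite eq_sym.
  exists (nat_of_bool (~~ g)); first by case: g; lia.
  rewrite a0 b0 /line_meet /lo /hi.
  by case: g; case: s u su => -[] //= _; lia.
exists (nat_of_bool (s != u)); first by case: (s != u); lia.
rewrite /line_meet /lo /hi.
by case: g gh; case: h => // _; case: s; case: u => /=; do ?[case: ifP => _]; lia.
Qed.

(** The block on a group's own line reveals group and side; the position on the other group's line
    reveals the index. *)
Lemma ends_inj q t (g s : bool) (a : nat) (h u : bool) (b : nat) :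
  1 < q -> a < q -> b < q ->
  (forall j, j < 2 -> lo q t j g s a = lo q t j h u b /\
    hi q t j g s a = hi q t j h u b) ->
  [/\ g = h, s = u & a = b].
Proof.
move=> q1 aq bq E; have [] := E 0 isT; have [] := E 1 isT.
clear E; rewrite /lo /hi; case: g; case: h; case: s; case: u => /=;
  by case: (eqVneq a 0) => ?; case: (eqVneq b 0) => ? *; split; lia.
Qed.

(** * From integer end points to sets in the plane *)

Import Order.TTheory GRing.Theory Num.Theory.
Local Open Scope classical_set_scope.
Local Open Scope ring_scope.

Lemma mem_segment (R : realType) (p d z : plane R) (l h : R) : l <= h ->
  segment (p + l *: d) (p + h *: d) z <->
  exists2 s, l <= s <= h & z = p + s *: d.
Proof.
move=> lh; split=> [[u]|[s /andP[ls sh] ->]].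
  rewrite /= in_itv /= => /andP[u0 u1] <-; exists (l + u * (h - l)).
    by apply/andP; split; nra.
  by rewrite opprD addrACA subrr add0r -scalerBl scalerA -addrA -scalerDl.
have [lh0|lh0] := eqVneq l h.
  exists 0; first by rewrite /= in_itv /= lexx ler01.
  by rewrite scale0r addr0; congr (_ + _ *: _); lra.
have hl : 0 < h - l by rewrite subr_gt0 lt_neqAle lh0.
exists ((s - l) / (h - l)).
  rewrite /= in_itv /= divr_ge0 ?subr_ge0 //=.
  by rewrite ler_pdivrMr // mul1r lerB.
rewrite opprD addrACA subrr add0r -scalerBl scalerA -addrA -scalerDl.
by rewrite divfK ?gt_eqF // [l + _]addrC subrK.
Qed.

Lemma line_coord_inj (R : realType) (p d : plane R) : d != 0 ->
  injective (fun s : R => p + s *: d).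
Proof.
move=> d0 s s' /addrI /eqP; rewrite -subr_eq0 -scalerBl scaler_eq0.
by rewrite (negbTE d0) orbF subr_eq0 => /eqP.
Qed.

Section Realization.
Variables (R : realType) (t : nat) (p : 'I_t -> plane R) (d : plane R).
Hypothesis d0 : d != 0.
Hypothesis tL : trivIset setT (fun j => line (p j) d).

Definition nat_interval (lo hi : nat) (j : 'I_t) : set (plane R) :=
  segment (p j + lo%:R *: d) (p j + hi%:R *: d).

Lemma nat_interval_line lo hi j : (lo <= hi)%N ->
  nat_interval lo hi j `<=` line (p j) d.
Proof.
move=> lh z /mem_segment; rewrite ler_nat => /(_ lh)[s _ ->].
by exists s.
Qed.

Lemma mem_nat_intervals (lo hi : 'I_t -> nat) (j : 'I_t) (s : R) :
    (forall k, (lo k <= hi k)%N) ->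
  (\bigcup_k nat_interval (lo k) (hi k) k) (p j + s *: d) <->
  (lo j)%:R <= s <= (hi j)%:R.
Proof.
move=> lh; split=> [[k _ ks]|sj]; last first.
  by exists j => //; apply/mem_segment; [rewrite ler_nat|exists s].
have kj : k = j.
  apply: tL => //; exists (p j + s *: d); split; last by exists s.
  exact: nat_interval_line ks.
move: ks; rewrite kj => /mem_segment; rewrite ler_nat => /(_ (lh _))[s' s'b].
by move=> /(line_coord_inj d0) ->.
Qed.

End Realization.

Lemma realize_intervals (R : realType) (t : nat) (L : 'I_t -> set (plane R))
    (V : finType) (lo hi : 'I_t -> V -> nat) (n m : nat) :
  disjoint_parallel_lines L ->
  (forall j v, (lo j v <= hi j v)%N) ->
  (forall v w, (forall j, lo j v = lo j w /\ hi j v = hi j w) -> v = w) ->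
  (forall v w, exists j, (lo j v <= hi j w)%N && (lo j w <= hi j v)%N) ->
  (n <= #|V|)%N ->
  (forall x : 'I_t -> nat,
    (#|[set v | [exists j, (lo j v <= x j <= hi j v)%N]]%SET| <= m)%N) ->
  exists H : {fset (set (plane R))},
    [/\ forall A, A \in H -> is_t_interval L A,
        pairwise_intersecting [set` H],
        #|` H| = n
      & forall F : {fset (set (plane R))}, (F `<=` H)%fset ->
          weakly_intersecting L [set` F] -> (#|` F| <= m)%N].
Proof.
move=> [[d d0 /choice[p Lp]] tL] lh inj meet nV cover.
have {}tL : trivIset setT (fun j => line (p j) d).
  by rewrite (_ : (fun j => _) = L) //; apply/funext => j; rewrite Lp.
pose A v : set (plane R) := \bigcup_j nat_interval p d (lo j v) (hi j v) j.
have memA v j s : A v (p j + s *: d) <-> (lo j v)%:R <= s <= (hi j v)%:R.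
  exact: (mem_nat_intervals d0 tL).
have Ainj : injective A.
  move=> v w vw; apply: inj => j.
  have E (s : R) : ((lo j v)%:R <= s <= (hi j v)%:R) <-> ((lo j w)%:R <= s <= (hi j w)%:R).
    by rewrite -!memA vw.
  have := (E (lo j v)%:R).1; have := (E (hi j v)%:R).1.
  have := (E (lo j w)%:R).2; have := (E (hi j w)%:R).2.
  rewrite !ler_nat !leqnn !lh /= => /(_ isT) + /(_ isT) + /(_ isT) + /(_ isT); lia.
(* Any [n] members will do, as every required property passes to subfamilies. *)
pose s := take n (enum V).
have us : uniq s by rewrite take_uniq ?enum_uniq.
exists [fset A v | v in s]%fset; split.
- move=> _ /imfsetP[v _ ->]; exists (fun j => nat_interval p d (lo j v) (hi j v) j).
  split=> // j; split; first by do 2!eexists.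
  by rewrite Lp; apply: nat_interval_line.
- move=> _ _ /imfsetP[v _ ->] /imfsetP[w _ ->] _.
  have [j vw] := meet v w.
  exists (p j + (maxn (lo j v) (lo j w))%:R *: d); split; apply/memA; rewrite !ler_nat;
    have := lh j v; have := lh j w; lia.
- rewrite card_imfset //= undup_id //.
  by rewrite size_take -cardE; case: ltngtP nV.
move=> F FH [P [P1 PF]].
have /choice[x xP] : forall j, exists y : nat, forall v,
    (exists2 z, A v z & P z /\ L j z) -> (lo j v <= y <= hi j v)%N.
  move=> j.
  have [[z0 [Pz0 Lz0]]|nz] := pselect (exists z, P z /\ L j z); last first.
    by exists 0%N => v [z _ Pz]; case: nz; exists z.
  have [y _ yz0] : line (p j) d z0 by rewrite -Lp.
  (* Rounding down is harmless: an interval with natural end points that contains [y] also contains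
     its integer part. *)
  exists (Num.truncn y) => v [z Avz Pz].
  have zz0 : z = z0 by exact: (P1 j _ _ Pz (conj Pz0 Lz0)).
  move: Avz; rewrite zz0 -yz0 memA => /andP[ly yh].
  have y0 : 0 <= y by apply: le_trans ly; rewrite ler0n.
  rewrite truncn_ge_nat // ly /=.
  by rewrite truncn_le_nat (le_lt_trans yh) // ltr_nat.
apply: leq_trans (cover x).
set T := [set v | _]%SET.
apply: (@leq_trans #|` [fset A v | v in T]%fset|); last first.
  by rewrite card_imfset //= -cardE.
apply: fsubset_leq_card; apply/fsubsetP => B BF.
have /imfsetP[v _ Bv] := fsubsetP FH B BF.
apply/imfsetP; exists v => //=.
have [z [Bz Pz]] := PF B BF.
move: (Bz); rewrite Bv => -[j _ /nat_interval_line zj].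
rewrite inE; apply/existsP; exists j; apply: xP.
by exists z; [rewrite -Bv|split=> //; rewrite Lp; apply: zj].
Qed.

(* For t = 2 the bound is n, and the family without structured members (q = 0)
   will do. *)
Section Family.
Variables (q t r : nat).
Hypothesis t1 : (1 < t)%N.
Hypothesis qt : q = 0%N \/ [/\ (1 < q)%N, (2 < t)%N & (t <= q.+1)%N].

Local Notation V := (bool * bool * 'I_q + 'I_r)%type.

Definition left_end (j : 'I_t) (v : V) : nat :=
  match v with
  | inl x => lo q t j x.1.1 x.1.2 x.2
  | inr _ => 0
  end.

Definition right_end (j : 'I_t) (v : V) : nat :=
  match v with
  | inl x => hi q t j x.1.1 x.1.2 x.2
  | inr i => if j == 0%N :> nat then (q.*2.+1 + i)%N else 0
  end.

Lemma q_bounds (a : 'I_q) : [/\ (1 < q)%N, (2 < t)%N & (t <= q.+1)%N].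
Proof. by case: qt => // q0; have := ltn_ord a; lia. Qed.

Let j0 : 'I_t := Ordinal (ltnW t1).
Let j1 : 'I_t := Ordinal t1.

Lemma lo_hi_line0 (x : bool * bool * 'I_q) :
  (lo q t 0 x.1.1 x.1.2 x.2 <= q.*2)%N /\ (hi q t 0 x.1.1 x.1.2 x.2 <= q.*2)%N.
Proof.
have := ltn_ord x.2; case: x => -[g s] a /=.
by rewrite /lo /hi; case: g; case: s => /=; do ?[case: ifP => _]; lia.
Qed.

Lemma left_le_right j v : (left_end j v <= right_end j v)%N.
Proof. by case: v => [x|i] //=; apply: lo_le_hi. Qed.

Lemma ends_injective v w :
  (forall j, left_end j v = left_end j w /\ right_end j v = right_end j w) ->
  v = w.
Proof.
case: v w => [x|i] [y|k] E.
- have [q1 t2 _] := q_bounds x.2.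
  have [] := @ends_inj q t x.1.1 x.1.2 x.2 y.1.1 y.1.2 y.2 q1 _ _ _ => //.
    by case=> [|[|//]] _; [apply: (E j0)|apply: (E j1)].
  by case: x y {E} => -[g s] a [[h u] b] /= -> -> /val_inj ->.
- by have := (lo_hi_line0 x).2; have := (E j0).2 => /=; lia.
- by have := (lo_hi_line0 y).2; have := (E j0).2 => /=; lia.
- by have := (E j0).2 => /= ik; congr inr; apply: val_inj => /=; lia.
Qed.

Lemma ends_meet v w : exists j,
  (left_end j v <= right_end j w)%N && (left_end j w <= right_end j v)%N.
Proof.
case: v w => [x|i] [y|k]; last 3 first.
- by exists j0 => /=; have := lo_hi_line0 x; lia.
- by exists j0 => /=; have := lo_hi_line0 y; lia.
- by exists j0.
have [q1 t2 _] := q_bounds x.2.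
have [j jt xy] := pairwise_meet x.1.1 x.1.2 y.1.1 y.1.2 q1 t2
  (ltn_ord x.2) (ltn_ord y.2).
by exists (Ordinal jt).
Qed.

Lemma card_family : #|{: V}| = (4 * q + r)%N.
Proof. by rewrite card_sum !card_prod card_bool !card_ord. Qed.

Lemma card_family_cover (x : 'I_t -> nat) :
  (#|[set v | [exists j, (left_end j v <= x j <= right_end j v)%N]]%SET|
    <= 3 * q + r)%N.
Proof.
set U := [set v | _]%SET.
pose W := [set y : bool * bool * 'I_q |
  [exists j : 'I_t, y.2 \in fiber q t j (x j) y.1.1 y.1.2]]%SET.
apply: (@leq_trans #|(inl @: W :|: inr @: [set: 'I_r])%SET|).
  apply/subset_leq_card/fintype.subsetP => -[y|i] /=; rewrite !inE => Uv.
    apply/orP; left; apply: imset_f; rewrite inE.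
    by case/existsP: Uv => j yj; apply/existsP; exists j; rewrite inE.
  by apply/orP; right; apply: imset_f; rewrite inE.
apply: leq_trans (leq_card_setU _ _) _; apply: leq_add; last first.
  by apply: leq_trans (leq_imset_card _ _) _; rewrite cardsT card_ord.
apply: leq_trans (leq_imset_card _ _) _.
case: qt => [q0|[q1 t2 tq]]; last exact: card_cover.
apply: leq_trans (max_card _) _.
by rewrite !card_prod card_ord q0 muln0.
Qed.

End Family.

(** * Choice of parameters and the final estimate *)

Theorem theorem1p3 (R : realType) (t n : nat) (L : 'I_t -> set (plane R))
    (ht : (2 <= t)%N) (hn : (4 * t - 5 <= n)%N)
    (hL : disjoint_parallel_lines L) :
  exists H : {fset (set (plane R))},
    [/\ forall A, A \in H -> is_t_interval L A,
        pairwise_intersecting [set` H],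
        #|` H| = n
      & forall F : {fset (set (plane R))}, (F `<=` H)%fset ->
          weakly_intersecting L [set` F] ->
          #|` F|%:R <= (3 * (t%:R - 1)) / (4 * t%:R - 5) * n%:R :> R].
Proof.
pose q := if t == 2%N then 0%N else maxn t.-1 (n %/ 4).
pose r := (n - 4 * q)%N.
have qt : q = 0%N \/ [/\ (1 < q)%N, (2 < t)%N & (t <= q.+1)%N].
  by rewrite /q; case: eqVneq => [|t2]; [left|right; split; lia].
have nV : (n <= #|{: bool * bool * 'I_q + 'I_r}|)%N by rewrite card_family; lia.
have [H [tH pH nH wH]] := realize_intervals hL (@left_le_right q t r)
  (@ends_injective q t r ht qt) (@ends_meet q t r ht qt) nV
  (@card_family_cover q t r qt).
exists H; split=> // F FH /(wH F FH) Fm.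
(* If q = n/4 rounded down, then 3q + r = n - q and the claim is n(t-2) <= q(4t-5), which follows
   from n <= 4q+3 and t-2 <= q. Otherwise, for t > 2, n = 4t-5, q = t-1 and r = 0 give equality. *)
have le_nat : ((3 * q + r) * (4 * t - 5) <= 3 * (t - 1) * n)%N.
  rewrite /r /q; case: eqVneq => [->|t2]; first lia.
  have [tn|tn] := leqP t.-1 (n %/ 4); last first.
    have -> : n = (4 * t - 5)%N by lia.
    by apply: leq_mul => //; lia.
  have := leq_trunc_div n 4; nia.
have -> : 3 * (t%:R - 1) / (4 * t%:R - 5) * n%:R =
    (3 * (t - 1) * n)%:R / (4 * t - 5)%:R :> R.
  rewrite !natrM !natrB ?natrM; [|lia|lia].
  by rewrite mulrAC.
rewrite ler_pdivlMr ?ltr0n; last lia.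
rewrite -natrM ler_nat; apply: leq_trans le_nat.
by rewrite leq_mul2r Fm orbT.
Qed.
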